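(* There exists a Banach space $X$ with a subprojective subspace $Y$ such that, for every $\varepsilon > 0$, $X$ contains a non-subprojective subspace $Z$ with $\Theta_X(Y,Z) \leq \varepsilon$.
   Context: Subspaces are closed and infinite dimensional. A Banach space $X$ is subprojective if every closed infinite dimensional subspace $Y \subset X$ contains a closed infinite dimensional subspace $Z \subset Y$ that is complemented in $X$. For subspaces $Y, Z$ of a Banach space $X$, the gap (or opening) is $$\Theta_X(Y,Z) = \max\Big\{ \sup_{y \in Y, \|y\|=1} \mathrm{dist}(y,Z),\ \sup_{z \in Z, \|z\|=1} \mathrm{dist}(z,Y) \Big\}.$$ *)

(* Defs.v *)
From HB Require Import structures.
From mathcomp Require Import all_boot all_order all_algebra.
From mathcomp Require Import all_classical all_reals all_analysis.

Set Implicit Arguments.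
Unset Strict Implicit.
Unset Printing Implicit Defensive.

Import Order.TTheory GRing.Theory Num.Theory.
Import numFieldNormedType.Exports.

Local Open Scope classical_set_scope.
Local Open Scope ring_scope.

Definition infinite_dimensional (R : realType) (V : lmodType R) (A : set V) :=
  forall n : nat, exists v : 'I_n -> V, (forall i, A (v i)) /\
    forall c : 'I_n -> R, \sum_(i < n) c i *: v i = 0 -> forall i, c i = 0.

(* A subspace is by convention closed and infinite dimensional. *)
Record banach_subspace (R : realType) (X : completeNormedModType R) :=
  BanachSubspace {
    subspace_set :> set X;
    subspace_submod_closed : submod_closed [in subspace_set];
    subspace_closed : closed subspace_set;
    subspace_infinite_dimensional : infinite_dimensional subspace_set
  }.

(* The subspace Y, with the norm of X, as a Banach space in its own right. *)
Record space_of (R : realType) (X : completeNormedModType R)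
    (Y : banach_subspace X) := SpaceOf {
  space_val : X;
  space_valP : space_val \in subspace_set Y
}.

Section BanachSpaceOfSubspace.
Context (R : realType) (X : completeNormedModType R) (Y : banach_subspace X).

HB.instance Definition _ := [isSub for @space_val R X Y].
HB.instance Definition _ := [Choice of space_of Y by <:].
HB.instance Definition _ := GRing.SubChoice_isSubLmodule.Build R X
  [in subspace_set Y] (space_of Y) (subspace_submod_closed Y).

Let snorm (u : space_of Y) : R := `|space_val u|.

Let snormD u v : snorm (u + v) <= snorm u + snorm v.
Proof. by rewrite /snorm -[space_val (u + v)]/(val (u + v)) raddfD ler_normD. Qed.

Let snormZ (a : R) u : snorm (a *: u) = `|a| * snorm u.
Proof. by rewrite /snorm -[space_val (a *: u)]/(val (a *: u)) linearZ normrZ. Qed.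

Let snorm0_eq0 u : snorm u = 0 -> u = 0.
Proof. by move=> /normr0_eq0 u0; apply: val_inj; rewrite raddf0. Qed.

HB.instance Definition _ := Lmodule_isNormed.Build R (space_of Y)
  snormD snormZ snorm0_eq0.

Let space_complete (F : set_system (space_of Y)) :
  ProperFilter F -> cauchy F -> cvg F.
Proof.
move=> FF /cauchy_ballP Fc.
have /cauchy_cvg/cvg_ex[/= l Fl] : cauchy (@space_val R X Y @ F).
  apply/cauchy_ballP => e e0; have [[A B] /= [FA FB] AB] := Fc e e0.
  exists (@space_val R X Y @` A, @space_val R X Y @` B) => /=.
    by split; [apply: filterS FA|apply: filterS FB] => u Au; exists u.
  move=> [_ _] /= [[u Au <-] [v Bv <-]].
  by move: (AB (u, v) (conj Au Bv)); rewrite -!ball_normE.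
have Yl : l \in subspace_set Y.
  rewrite inE; apply: (closed_cvg _ (subspace_closed (b := Y)) _ _ Fl).
  by apply: nearW => u; exact/set_mem/space_valP.
apply/cvg_ex; exists (SpaceOf Yl); apply/cvgrPdist_lt => e e0.
by move/cvgrPdist_lt : Fl => /(_ e e0).
Qed.

HB.instance Definition _ :=
  Uniform_isComplete.Build (space_of Y) space_complete.

End BanachSpaceOfSubspace.

Definition complemented (R : realType) (X : completeNormedModType R)
    (Z : set X) :=
  exists P : {linear X -> X},
    [/\ continuous P, forall x, P (P x) = P x & range P = Z].

Definition subprojective (R : realType) (X : completeNormedModType R) :=
  forall Y : banach_subspace X,
    exists Z : banach_subspace X, Z `<=` Y /\ complemented Z.

(* The infimum and suprema are taken in R.  For subspaces Y and Z the sets are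
   nonempty and bounded (distances of unit vectors lie in [0, 1]), so the
   default value 0 of inf and sup is never used. *)
Definition dist (R : realType) (X : normedModType R) (x : X) (A : set X) : R :=
  inf [set `|x - a| | a in A].

Definition gap (R : realType) (X : normedModType R) (Y Z : set X) : R :=
  Num.max (sup [set dist y Z | y in [set y | Y y /\ `|y| = 1]])
          (sup [set dist z Y | z in [set z | Z z /\ `|z| = 1]]).

(* Main.v *)
Require Import Defs.
From HB Require Import structures.
From mathcomp Require Import all_boot all_order all_algebra.
From mathcomp Require Import all_classical all_reals all_analysis.
From mathcomp Require Import ring lra.
Set Implicit Arguments.
Unset Strict Implicit.
Unset Printing Implicit Defensive.

Import Order.TTheory GRing.Theory Num.Theory.
Import numFieldNormedType.Exports.
Local Open Scope classical_set_scope.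
Local Open Scope ring_scope.

(** Put omega(a) = a ln |a|. The space X consists of the sequences of triples
    (y_i, x_i, b_i) on which the following functionals are bounded, for v
    finitely supported of l2-norm at most 1: the sums of v_i b_i, of v_i x_i,
    and of v_i y_i - omega(v_i) x_i. The norm is the supremum of their
    absolute values. So X is l2 (the b_i) plus a form of the twisted Hilbert
    space of Kalton and Peck (the pairs (y_i, x_i)), which contains l2 as {x =
    0} with quotient l2. Norming by functionals in this self-dual way makes
    the triangle inequality and completeness automatic, and the only analysis
    left is the inequality |omega(a) b - a omega(b)| <= a^2 + b^2
    ([entropy_antisymmetric_le]): it says that (t omega(b), t b, 0) has norm
    at most 2 t when b is in the unit ball of l2 ([exists_entropy_lift]).

    For t >= 0 let Z_t be the subspace {x = t b} ([slice]), and Y = Z_0.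

    - Adding or subtracting (t omega(b), t b, 0) moves Y to Z_t and back, so
      that the gap is at most 2 t ([gap_slice_le]).

    - On Y the norm is equivalent to the Hilbert norm of l2 + l2, so every
      closed subspace of Y is complemented by an orthogonal projection
      ([subprojective_slice0]).

    - For t > 0, Z_t is isomorphic to the space of the pairs (y_i, x_i), and
      no infinite dimensional V inside its fiber {b = 0}, a copy of l2, is complemented
      ([not_complemented_in_fiber]). Suppose that P projects Z_t onto V.
      Choose n = m^2 disjointly supported fiber vectors u_k of norm at most 1,
      so close to unit vectors of V that |P u_k| >= 1/2, and let z_k lift u_k,
      that is, z_k = (t omega(u_k), t u_k, u_k). As omega is a derivation for
      products, the lift of the l2-bounded vector m^-1 sum_k s_k u_k, with
      signs s_k, is m^-1 sum_k s_k (z_k - t (ln m) u_k). All lifts being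
      bounded, the vectors w_k = P z_k - t (ln m) P u_k satisfy |sum_k s_k
      w_k| <= K m, with K independent of m and of the signs. In the Hilbert
      space {b = 0} some choice of signs gives |sum_k s_k w_k|^2 >= sum_k
      |w_k|^2, which is at least m^2 (t (ln m) / 2 - K)^2 for large m. Hence
      ln m is bounded, which is absurd. *)

(** * Subspaces and linear forms *)

Section SubspaceTheory.
Context (R : realType) (H : completeNormedModType R) (W : banach_subspace H).

Lemma subspace_set0 : subspace_set W 0.
Proof. by have [] := subspace_submod_closed W; rewrite inE. Qed.

Lemma subspace_set_linear a u v :
  subspace_set W u -> subspace_set W v -> subspace_set W (a *: u + v).
Proof.
have [_ Wlin] := subspace_submod_closed W.
by move=> Wu Wv; have := Wlin a u v; rewrite !inE; exact.
Qed.

Lemma subspace_setZ a u : subspace_set W u -> subspace_set W (a *: u).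
Proof.
by move=> Wu; rewrite -[_ *: _]addr0; apply: subspace_set_linear => //;
  exact: subspace_set0.
Qed.

Lemma subspace_setB u v :
  subspace_set W u -> subspace_set W v -> subspace_set W (u - v).
Proof.
by move=> Wu Wv; rewrite addrC -scaleN1r; exact: subspace_set_linear.
Qed.

Lemma subspace_set_sum (I : Type) (r : seq I) (F : I -> H) :
  (forall i, subspace_set W (F i)) -> subspace_set W (\sum_(i <- r) F i).
Proof.
move=> WF; elim/big_rec : _ => [|i u _ Wu]; first exact: subspace_set0.
by rewrite -[F i]scale1r; exact: subspace_set_linear.
Qed.

End SubspaceTheory.

Section LinearForms.
Context (R : realType) (V : lmodType R).

Lemma scalar_sumZ (f : V -> R) (I : Type) (r : seq I) (c : I -> R)
    (v : I -> V) :
  scalar f -> f (\sum_(i <- r) c i *: v i) = \sum_(i <- r) c i * f (v i).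
Proof.
move=> flin.
pose g : {scalar V} := HB.pack f (GRing.isLinear.Build _ _ _ _ f flin).
rewrite -[f]/(g : V -> R) linear_sum.
by apply: eq_bigr => i _; rewrite linearZ.
Qed.

Lemma joint_kernel_submod_closed (J : Type) (f : J -> V -> R) :
  (forall j, scalar (f j)) ->
  submod_closed [in [set u | forall j, f j u = 0]].
Proof.
move=> flin; split; first rewrite inE => j.
  by have := flin j (-1) 0 0; rewrite scaler0 addr0 mulN1r addNr.
move=> a u v; rewrite !inE => u0 v0 j.
by rewrite (flin j) u0 v0 mulr0 addr0.
Qed.

Lemma biorthogonal_infinite_dimensional (A : set V) (v : nat -> V)
    (f : nat -> V -> R) :
  (forall i, scalar (f i)) -> (forall i j, f i (v j) = (i == j)%:R) ->
  (forall i, A (v i)) -> infinite_dimensional A.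
Proof.
move=> flin fv Av n; exists (fun i : 'I_n => v i); split=> // c c0 i.
have := scalar_sumZ (index_enum 'I_n) c (fun i : 'I_n => v i) (flin i).
rewrite c0 (bigD1 i)//= big1 => [|j ji].
  rewrite fv eqxx mulr1 addr0 => <-.
  by have := flin i (-1) 0 0; rewrite scaler0 addr0 mulN1r addNr.
by rewrite fv eq_sym (inj_eq (@ord_inj n)) (negbTE ji) mulr0.
Qed.

End LinearForms.

Lemma lipschitz_joint_kernel_closed (R : realType) (V : normedModType R)
    (J : Type) (f : J -> V -> R) :
  (forall j u v, `|f j u - f j v| <= `|u - v|) ->
  closed [set u | forall j, f j u = 0].
Proof.
move=> flip u clu j; apply: normr0_eq0; apply/le_anti; rewrite normr_ge0 andbT.
apply/ler_addgt0Pr => e e0; rewrite add0r.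
have [v [v0 uv]] := clu _ (nbhsx_ballx u e e0).
rewrite -[f j u]subr0 -(v0 j); apply: le_trans (flip _ _ _) _.
by move: uv; rewrite -ball_normE /= => /ltW.
Qed.

(** The forms define a linear map to R^n, which has a kernel on the span of any
    n + 1 independent vectors of W. *)
Lemma subspace_nonzero_in_kernels (R : realType) (H : completeNormedModType R)
    (W : banach_subspace H) (n : nat) (f : 'I_n -> H -> R) :
  (forall i, scalar (f i)) ->
  exists u, [/\ subspace_set W u, u != 0 & forall i, f i u = 0].
Proof.
move=> flin.
have [v [Wv vfree]] := subspace_infinite_dimensional W n.+1.
pose M := \matrix_(i < n.+1, j < n) f j (v i).
have : kermx M != 0.
  by rewrite -mxrank_eq0 mxrank_ker -lt0n subn_gt0 ltnS rank_leq_col.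
move=> /rowV0Pn[c /sub_kermxP cM c0].
exists (\sum_(i < n.+1) c 0 i *: v i); split.
- by apply: subspace_set_sum => i; exact: subspace_setZ.
- apply: contra_neq c0 => /vfree c0; apply/rowP => i; rewrite mxE; exact: c0.
- move=> j; rewrite scalar_sumZ//.
  transitivity ((c *m M) 0 j); last by rewrite cM mxE.
  by rewrite mxE; apply: eq_bigr => i _; rewrite mxE.
Qed.

Lemma gap_le (R : realType) (X : normedModType R) (Y Z : set X) (c : R) :
  0 <= c ->
  (forall y, Y y -> `|y| = 1 -> exists2 z, Z z & `|y - z| <= c) ->
  (forall z, Z z -> `|z| = 1 -> exists2 y, Y y & `|z - y| <= c) ->
  gap Y Z <= c.
Proof.
move=> c0 YZ ZY.
have half (A B : set X) :
    (forall y, A y -> `|y| = 1 -> exists2 z, B z & `|y - z| <= c) ->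
    sup [set dist y B | y in [set y | A y /\ `|y| = 1]] <= c.
  move=> AB; set D := [set _ | _ in _].
  have [->|/set0P D0] := eqVneq D set0; first by rewrite sup0.
  apply: ge_sup => // _ [y [Ay y1] <-]; have [z Bz yz] := AB y Ay y1.
  apply: le_trans yz; apply: ge_inf; last by exists z.
  by exists 0 => _ [a _ <-].
by rewrite /gap ge_max !half.
Qed.

(** The signs are chosen one after the other: by the parallelogram inequality,
    one of S + w and S - w has squared norm at least |S|^2 + |w|^2. *)
Lemma exists_signs_norm_ge (R : realType) (V : normedModType R) (A : set V) :
  (forall u v, A u -> A v ->
    2 * (`|u| ^+ 2 + `|v| ^+ 2) <= `|u + v| ^+ 2 + `|u - v| ^+ 2) ->
  A 0 -> (forall a u v, A u -> A v -> A (a *: u + v)) ->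
  forall (w : nat -> V), (forall k, A (w k)) -> forall n,
  exists s : nat -> R, (forall k, `|s k| = 1) /\
    \sum_(0 <= k < n) `|w k| ^+ 2 <= `|\sum_(0 <= k < n) s k *: w k| ^+ 2.
Proof.
move=> par A0 Alin w Aw; elim=> [|n [s [s1 IH]]].
  by exists (fun=> 1); split => [k|]; rewrite ?normr1// !big_nil normr0 expr0n.
set S := \sum_(_ <= _ < _) _ *: _ in IH.
have AS : A S.
  rewrite /S; elim/big_rec: _ => // k u _ Au; exact: Alin.
have [c c1 hc] : exists2 c : R, `|c| = 1 &
    `|S| ^+ 2 + `|w n| ^+ 2 <= `|S + c *: w n| ^+ 2.
  have := par S (w n) AS (Aw n).
  have [h _|h h2] := leP (`|S| ^+ 2 + `|w n| ^+ 2) (`|S + w n| ^+ 2).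
    by exists 1; rewrite ?normr1 ?scale1r.
  exists (-1); rewrite ?normrN1// scaleN1r.
  by move: h h2; lra.
exists (fun k => if k == n then c else s k); split=> [k|]; first by case: ifP.
rewrite !big_nat_recr//= eqxx.
have -> : \sum_(0 <= k < n) (if k == n then c else s k) *: w k = S.
  rewrite /S; apply: eq_big_nat => k /andP[_ kn].
  by rewrite ltn_eqF.
by apply: le_trans hc; rewrite lerD2r.
Qed.

(** At each coordinate, a sum of disjointly supported sequences has at most one
    nonzero term, so any f with f 0 = 0 commutes with it, linear or not. *)
Lemma disjoint_sum (R : pzRingType) (f : R -> R) (a : nat -> R) n :
  f 0 = 0 -> (forall k l, k != l -> a k = 0 \/ a l = 0) ->
  f (\sum_(0 <= k < n) a k) = \sum_(0 <= k < n) f (a k).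
Proof.
move=> f0 dis; elim: n => [|n IHn]; first by rewrite !big_nil.
rewrite !big_nat_recr//= -IHn.
have [->|an] := eqVneq (a n) 0; first by rewrite f0 !addr0.
rewrite big1_seq ?f0 ?add0r// => k /andP[_].
rewrite mem_index_iota => /andP[_ kn].
by have [|//|/eqP] := dis k n; rewrite ?ltn_eqF// (negbTE an).
Qed.

(** * Closed subspaces of a Hilbertian space are complemented *)

Section HilbertProjection.
Context (R : realType) (H : completeNormedModType R) (s : H -> H -> R) (C : R).
Hypotheses (sC : forall u v, s u v = s v u)
  (sD : forall u u' v, s (u + u') v = s u v + s u' v)
  (sZ : forall a u v, s (a *: u) v = a * s u v)
  (s_le : forall u, s u u <= C * `|u| ^+ 2)
  (le_s : forall u, `|u| ^+ 2 <= s u u).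

Let sDr u v v' : s u (v + v') = s u v + s u v'.
Proof. by rewrite sC sD !(sC u). Qed.

Let sZr a u v : s u (a *: v) = a * s u v.
Proof. by rewrite sC sZ (sC u). Qed.

Let sN u v : s (- u) v = - s u v.
Proof. by rewrite -scaleN1r sZ mulN1r. Qed.

Let sNr u v : s u (- v) = - s u v.
Proof. by rewrite sC sN (sC u). Qed.

Let s_ge0 u : 0 <= s u u.
Proof. exact: le_trans (le_s u). Qed.

Let sE := (sD, sDr, sN, sNr, sZ, sZr).

(** By the parallelogram law, the sets B e of almost nearest points of W to x
    have diameters tending to 0 with e; they generate a Cauchy filter, whose
    limit is the projection. *)
Lemma orthogonal_projection_exists (W : banach_subspace H) (x : H) :
  exists w, subspace_set W w /\
    forall u, subspace_set W u -> s (x - w) u = 0.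
Proof.
have Wlin := subspace_set_linear (W := W).
have Wmid u v : subspace_set W u -> subspace_set W v ->
    subspace_set W (2^-1 *: (u + v)).
  move=> Wu Wv; by rewrite scalerDr; apply: Wlin => //; exact: subspace_setZ.
pose D := [set s (x - w) (x - w) | w in subspace_set W].
pose d := inf D.
have Dinf : has_inf D.
  split; first by exists (s (x - 0) (x - 0)), 0 => //; exact: subspace_set0.
  by exists 0 => _ [w _ <-].
have d_le w : subspace_set W w -> d <= s (x - w) (x - w).
  by move=> Ww; apply: ge_inf; [exact: Dinf.2 | exists w].
pose B e := [set w | subspace_set W w /\ s (x - w) (x - w) < d + e].
have B0 e : 0 < e -> B e !=set0.
  move=> e0; have [_ [w Ww <-] lt] := inf_adherent e0 Dinf.
  by exists w.
pose F := filter_from [set e : R | 0 < e] B.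
have FF : ProperFilter F.
  apply: filter_from_proper => [|e]; last exact: B0.
  apply: filter_from_filter; first by exists 1; exact: ltr01.
  move=> e e' /= e0 e0'; exists (Num.min e e'); first by rewrite /= lt_min e0.
  move=> w [Ww lt]; split; split => //; apply: lt_le_trans lt _;
    by rewrite lerD2l ge_min lexx ?orbT.
have FB e : 0 < e -> F (B e) by move=> e0; exists e.
have /cauchy_cvg/cvg_ex[/= w Fw] : cauchy F.
  apply/cauchy_ballP => e e0.
  have k0 : 0 < e ^+ 2 / 8 by rewrite divr_gt0// exprn_gt0.
  exists (B (e ^+ 2 / 8), B (e ^+ 2 / 8)); first by split; exact: FB.
  move=> [u v] /= [[Wu ltu] [Wv ltv]].
  have := d_le _ (Wmid u v Wu Wv) => ltm.
  rewrite -ball_normE /=.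
  rewrite -(ltr_pXn2r (n := 2)) ?nnegrE ?(ltW e0)//.
  apply: le_lt_trans (le_s _) _.
  move: ltu ltv ltm k0; rewrite !sE (sC u x) (sC v x) (sC v u).
  move: (e ^+ 2) => e2; lra.
have Ww : subspace_set W w.
  apply: (@closed_cvg _ _ _ FF id _ (@subspace_closed _ _ W) _ w Fw).
  by exists 1 => [|v []]; first exact: ltr01.
exists w; split => // u Wu.
set a := s (x - w) u.
(* Compare the nearly optimal v with v + t u; a small t then gives a = 0. *)
have key t : 2 * t * a <= 2 * t ^+ 2 * s u u.
  apply/ler_addgt0Pr => e e0.
  have C0 : 0 < Num.max C 1 by rewrite lt_max ltr01 orbT.
  have k0 : 0 < e / 2 by rewrite divr_gt0.
  have h0 : 0 < Num.sqrt (e / 2 / Num.max C 1) by rewrite sqrtr_gt0 divr_gt0.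
  have [v [[Wv ltv] ballv]] :
      exists v, B (e / 2) v /\ ball w (Num.sqrt (e / 2 / Num.max C 1)) v.
    apply: (@filter_ex _ F); apply: filterI; first exact: FB.
    by apply: Fw; exact: nbhsx_ballx.
  move: ballv; rewrite -ball_normE /= => ltwv.
  have swv : s (w - v) (w - v) <= e / 2.
    apply: le_trans (s_le _) _.
    have : `|w - v| ^+ 2 <= e / 2 / Num.max C 1.
      rewrite -[leRHS]sqr_sqrtr; last by rewrite ltW// divr_gt0.
      by rewrite lerXn2r ?nnegrE ?sqrtr_ge0// ltW.
    rewrite ler_pdivlMr// => h; apply: le_trans h.
    by rewrite mulrC ler_wpM2l ?sqr_ge0// le_max lexx.
  have := d_le _ (Wlin t u v Wu Wv).
  have := s_ge0 (w - v + t *: u).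
  move: swv ltv; rewrite /a !sE.
  rewrite (sC v x) (sC v w) (sC u x) (sC u v) (sC u w); lra.
have su1 : 0 < 2 * (s u u + 1) by rewrite mulr_gt0// ltr_wpDl.
(* The + 1 covers u = 0; any t a small positive multiple of a would do. *)
have := key (a / (2 * (s u u + 1))).
move: su1 (s_ge0 u); move: (s u u) => q q1 q0.
have -> : 2 * (a / (2 * (q + 1))) * a = a ^+ 2 / (q + 1).
  by field; lra.
have -> : 2 * (a / (2 * (q + 1))) ^+ 2 * q =
    a ^+ 2 / (q + 1) * (q / (2 * (q + 1))).
  by field; lra.
have a2 : 0 <= a ^+ 2 / (q + 1) by rewrite divr_ge0 ?sqr_ge0//; lra.
have qh : q / (2 * (q + 1)) <= 2^-1 by rewrite ler_pdivrMr//; lra.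
move=> h; have {}h : a ^+ 2 / (q + 1) <= 0 by nra.
apply/eqP; rewrite -sqrf_eq0; apply/eqP/le_anti; rewrite sqr_ge0 andbT.
by move: h; rewrite pmulr_lle0// invr_gt0; lra.
Qed.

(** The projection is characterized by orthogonality, hence linear; Pythagoras
    gives s (P x) (P x) <= s x x, hence its continuity. *)
Lemma closed_subspace_complemented (W : banach_subspace H) : complemented W.
Proof.
have Wlin := subspace_set_linear (W := W).
have [P PE] := choice (@orthogonal_projection_exists W).
have uniq x w : subspace_set W w ->
    (forall u, subspace_set W u -> s (x - w) u = 0) -> P x = w.
  move=> Ww ow; have [WP oP] := PE x.
  have WPw : subspace_set W (w - P x) by exact: subspace_setB.
  apply/esym/subr0_eq/normr0_eq0/eqP; rewrite -sqrf_eq0; apply/eqP/le_anti.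
  rewrite sqr_ge0 andbT; apply: le_trans (le_s _) _.
  have := ow _ WPw; have := oP _ WPw; rewrite !sE; lra.
have Plin : linear P.
  move=> a u v; apply: uniq => [|t Wt]; first exact: Wlin (PE u).1 (PE v).1.
  by have := (PE u).2 t Wt; have := (PE v).2 t Wt; rewrite !sE => h1 h2; nra.
pose Pl : {linear H -> H} := HB.pack P (GRing.isLinear.Build _ _ _ _ P Plin).
exists Pl; split.
- apply: bounded_linear_continuous; apply/linear_boundedP.
  exists (Num.max C 1); split; first by rewrite num_real.
  move=> r; rewrite gt_max => /andP[Cr r1] x.
  have r0 : 0 <= r by lra.
  rewrite -(ler_pXn2r (n := 2)) ?nnegrE ?mulr_ge0//.
  apply: le_trans (le_s _) _.
  have sx : s (P x) (P x) <= s x x.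
    have := (PE x).2 _ (PE x).1; have := s_ge0 (x - P x).
    rewrite !sE (sC (P x) x); lra.
  apply: le_trans sx _; apply: le_trans (s_le x) _.
  rewrite exprMn ler_wpM2r ?sqr_ge0//; nra.
- move=> x /=; apply: uniq; first exact: (PE x).1.
  by move=> u Wu; rewrite subrr -(scale0r u) sZ mul0r.
- apply/seteqP; split => [_ [x _ <-]|w Ww]; first exact: (PE x).1.
  exists w => //=; apply: uniq => // u Wu.
  by rewrite subrr -(scale0r u) sZ mul0r.
Qed.

End HilbertProjection.

(** * Spaces normed by finitely supported functionals *)

Section Pairing.
Context (R : realType) (I : Type).

(** A list of pairs (i, c) stands for the finitely supported functional
    sum of c w_i. *)
Definition pairing (g : seq (I * R)) (w : I -> R) : R :=
  \sum_(p <- g) p.2 * w p.1.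

Lemma pairingD g u v : pairing g (u + v) = pairing g u + pairing g v.
Proof.
by rewrite /pairing -big_split; apply: eq_bigr => p _; rewrite mulrDr.
Qed.

Lemma pairingZ g a u : pairing g (a *: u) = a * pairing g u.
Proof.
by rewrite /pairing mulr_sumr; apply: eq_bigr => p _; rewrite mulrCA.
Qed.

Lemma pairingB g u v : pairing g (u - v) = pairing g u - pairing g v.
Proof. by rewrite -scaleN1r pairingD pairingZ mulN1r. Qed.

Lemma cvg_pairing (T : Type) (F : set_system T) (FF : Filter F)
    (f : T -> I -> R) (l : I -> R) g :
  (forall i, (f x i) @[x --> F] --> l i) ->
  (pairing g (f x)) @[x --> F] --> pairing g l.
Proof.
move=> fl; rewrite /pairing; elim: g => [|p g IHg].
  by rewrite big_nil; under eq_fun do rewrite big_nil; exact: cvg_cst.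
rewrite big_cons; under eq_fun do rewrite big_cons.
by apply: cvgD => //; apply: cvgMr.
Qed.

End Pairing.

(** With the coordinates among the functionals, the supremum is a norm and not
    only a seminorm, and Cauchy filters converge coordinatewise. *)
Record norming_family (R : realType) (I : Type) := NormingFamily {
  functionals :> set (seq (I * R));
  coordinate_functional : forall i, exists2 g, functionals g &
    forall w, pairing g w = w i
}.

Definition bounded_on (R : realType) (I : Type) (G : norming_family R I) :=
  [set w : I -> R | exists M, forall g, functionals G g -> `|pairing g w| <= M].

Lemma bounded_on_submod_closed (R : realType) (I : Type)
  (G : norming_family R I) : submod_closed [in bounded_on G].
Proof.
split; first rewrite inE.
  by exists 0 => g _; rewrite -(scale0r 0) pairingZ mul0r normr0.
move=> a u v; rewrite !inE => -[M uM] [N vN].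
exists (`|a| * M + N) => g Gg; rewrite pairingD pairingZ.
apply: le_trans (ler_normD _ _) _; rewrite normrM lerD ?vN//.
by rewrite ler_wpM2l ?uM.
Qed.

Record normed_by (R : realType) (I : Type) (G : norming_family R I) :=
  NormedBy {
    family_val : I -> R;
    family_valP : family_val \in bounded_on G
  }.

Section NormedBy.
Context (R : realType) (I : Type) (G : norming_family R I).

HB.instance Definition _ := [isSub for @family_val R I G].
HB.instance Definition _ := [Choice of normed_by G by <:].
HB.instance Definition _ := GRing.SubChoice_isSubLmodule.Build R (I -> R)
  [in bounded_on G] (normed_by G) (bounded_on_submod_closed G).

Let snorm (u : normed_by G) : R :=
  sup [set `|pairing g (family_val u)| | g in functionals G].

Let pairing_le_snorm u g :
  functionals G g -> `|pairing g (family_val u)| <= snorm u.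
Proof.
move=> Gg; apply: sup_upper_bound; last by exists g.
split; first by exists `|pairing g (family_val u)|, g.
by have [M uM] := set_mem (family_valP u); exists M => _ [h Gh <-]; exact: uM.
Qed.

Let snorm_le u M : 0 <= M ->
  (forall g, functionals G g -> `|pairing g (family_val u)| <= M) ->
  snorm u <= M.
Proof.
move=> M0 uM; have [[g Gg]|G0] := pselect (exists g, functionals G g).
  apply: ge_sup => [|_ [h Gh <-]]; last exact: uM.
  by exists `|pairing g (family_val u)|, g.
rewrite /snorm; set A := [set _ | _ in _]; suff -> : A = set0 by rewrite sup0.
by rewrite -subset0 => x [g Gg _]; case: G0; exists g.
Qed.

Let snorm_ge0 u : 0 <= snorm u.
Proof.
have [[g Gg]|G0] := pselect (exists g, functionals G g).
  exact: le_trans (pairing_le_snorm u Gg).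
rewrite /snorm; set A := [set _ | _ in _]; suff -> : A = set0 by rewrite sup0.
by rewrite -subset0 => x [g Gg _]; case: G0; exists g.
Qed.

Let valD (u v : normed_by G) : family_val (u + v) = family_val u + family_val v.
Proof. by rewrite -[LHS]/(val (u + v)) raddfD. Qed.

Let valZ a (u : normed_by G) : family_val (a *: u) = a *: family_val u.
Proof. by rewrite -[LHS]/(val (a *: u)) linearZ. Qed.

Let snormD u v : snorm (u + v) <= snorm u + snorm v.
Proof.
apply: snorm_le => [|g Gg]; first by rewrite addr_ge0.
rewrite valD pairingD; apply: le_trans (ler_normD _ _) _.
by rewrite lerD ?pairing_le_snorm.
Qed.

Let snormZ (a : R) u : snorm (a *: u) = `|a| * snorm u.
Proof.
have le b v : snorm (b *: v) <= `|b| * snorm v.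
  apply: snorm_le => [|g Gg]; first by rewrite mulr_ge0.
  by rewrite valZ pairingZ normrM ler_wpM2l ?pairing_le_snorm.
apply/le_anti; rewrite le /=.
have [->|a0] := eqVneq a 0; first by rewrite normr0 mul0r.
have := le a^-1 (a *: u); rewrite scalerA mulVf// scale1r normfV.
by rewrite ler_pdivlMl ?normr_gt0.
Qed.

Let snorm0_eq0 u : snorm u = 0 -> u = 0.
Proof.
move=> u0; apply: val_inj; rewrite raddf0; apply/funext => i.
have [g Gg gi] := coordinate_functional G i.
have := pairing_le_snorm u Gg; rewrite u0 normr_le0 gi.
by move/eqP.
Qed.

HB.instance Definition _ := Lmodule_isNormed.Build R (normed_by G)
  snormD snormZ snorm0_eq0.

Lemma pairing_le_norm (u : normed_by G) g :
  functionals G g -> `|pairing g (family_val u)| <= `|u|.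
Proof. exact: pairing_le_snorm. Qed.

Lemma norm_le_pairing (u : normed_by G) M : 0 <= M ->
  (forall g, functionals G g -> `|pairing g (family_val u)| <= M) ->
  `|u| <= M.
Proof. exact: snorm_le. Qed.

Lemma family_valD (u v : normed_by G) :
  family_val (u + v) = family_val u + family_val v.
Proof. exact: valD. Qed.

Lemma family_valZ a (u : normed_by G) :
  family_val (a *: u) = a *: family_val u.
Proof. exact: valZ. Qed.

Lemma family_valB (u v : normed_by G) :
  family_val (u - v) = family_val u - family_val v.
Proof. by rewrite -scaleN1r family_valD family_valZ scaleN1r. Qed.

Lemma coordinate_le_norm (u : normed_by G) i : `|family_val u i| <= `|u|.
Proof.
have [g Gg <-] := coordinate_functional G i; exact: pairing_le_norm.
Qed.

Let family_complete (F : set_system (normed_by G)) :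
  ProperFilter F -> cauchy F -> cvg F.
Proof.
move=> FF /cauchy_ballP Fc.
have coord i : cvg (family_val u i @[u --> F]).
  apply: cauchy_cvg; apply/cauchy_ballP => e e0.
  have [[A B] /= [FA FB] AB] := Fc e e0.
  pose p (u : normed_by G) := family_val u i.
  exists (p @` A, p @` B) => /=.
    by split; [apply: filterS FA|apply: filterS FB] => u Au; exists u.
  move=> [_ _] /= [[u Au <-] [v Bv <-]].
  move: (AB (u, v) (conj Au Bv)); rewrite -!ball_normE /=; apply: le_lt_trans.
  by have := coordinate_le_norm (u - v) i; rewrite family_valB.
pose l i := lim (family_val u i @[u --> F]).
(* The bounds are uniform in g: they come from the ball condition, before the
   passage to the limit along v. *)
have Fl e : 0 < e -> \forall u \near F,
    forall g, functionals G g -> `|pairing g (l - family_val u)| <= e.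
  move=> e0; have [[A B] /= [FA FB] AB] := Fc e e0.
  apply: filterS FA => u Au g Gg; apply/ler_addgt0Pr => d d0.
  have /cvgrPdist_lt/(_ d d0) Fd :
      pairing g (family_val v) @[v --> F] --> pairing g l by exact: cvg_pairing.
  have [v [Bv /= dv]] := filter_ex (filterI FB Fd).
  have := AB (u, v) (conj Au Bv); rewrite -ball_normE /= => /ltW euv.
  have := le_trans (pairing_le_norm (u - v) Gg) euv.
  move: dv; rewrite family_valB !pairingB => h1 h2.
  rewrite (_ : _ - _ = (pairing g l - pairing g (family_val v)) -
    (pairing g (family_val u) - pairing g (family_val v))); last by ring.
  by apply: le_trans (ler_normB _ _) _; rewrite addrC lerD// ltW.
have lG : l \in bounded_on G.
  rewrite inE; have [u ul] := filter_ex (Fl 1 ltr01).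
  exists (1 + `|u|) => g Gg.
  rewrite -[l](subrK (family_val u)) pairingD.
  by apply: le_trans (ler_normD _ _) _; rewrite lerD ?ul ?pairing_le_norm.
apply/cvg_ex; exists (NormedBy lG); apply/cvgrPdist_le => e e0.
apply: filterS (Fl e e0) => u ul; apply: norm_le_pairing; first exact: ltW.
by move=> g Gg; rewrite family_valB ul.
Qed.

HB.instance Definition _ :=
  Uniform_isComplete.Build (normed_by G) family_complete.

End NormedBy.

(** * Entropy and square-summable sequences *)

Section Entropy.
Context (R : realType).

(** As ln 0 is multiplied by 0, this is the continuous extension of a ln |a|. *)
Definition entropy (a : R) : R := a * ln `|a|.

Lemma entropy0 : entropy 0 = 0.
Proof. by rewrite /entropy mul0r. Qed.

Lemma entropy_sign a : `|a| = 1 -> entropy a = 0.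
Proof. by rewrite /entropy => ->; rewrite ln1 mulr0. Qed.

(** This derivation rule replaces linearity in the study of the twisted sum. *)
Lemma entropyM a b : entropy (a * b) = a * entropy b + b * entropy a.
Proof.
have [->|a0] := eqVneq a 0; first by rewrite !mul0r entropy0; ring.
have [->|b0] := eqVneq b 0; first by rewrite !mulr0 entropy0; ring.
by rewrite /entropy normrM lnM ?posrE ?normr_gt0//; ring.
Qed.

(** For a, b nonzero the left side is |a| |b| |ln (|a| / |b|)|, and ln q <= q for
    the one of |a| / |b|, |b| / |a| that is at least 1. *)
Lemma entropy_antisymmetric_le a b :
  `|entropy a * b - a * entropy b| <= a ^+ 2 + b ^+ 2.
Proof.
wlog ab : a b / `|b| <= `|a|.
  move=> h; have [/h//|/ltW/h hba] := leP `|b| `|a|.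
  by rewrite distrC (addrC (a ^+ 2)) (mulrC a) (mulrC (entropy a)).
have [->|b0] := eqVneq b 0.
  by rewrite entropy0 !mulr0 subrr normr0 addr_ge0// sqr_ge0.
have nb : 0 < `|b| by rewrite normr_gt0.
have na : 0 < `|a| by exact: lt_le_trans ab.
have -> : entropy a * b - a * entropy b = a * b * ln (`|a| / `|b|).
  by rewrite ln_div ?posrE// /entropy; ring.
have q1 : 1 <= `|a| / `|b| by rewrite ler_pdivlMr// mul1r.
rewrite !normrM (ger0_norm (ln_ge0 q1)).
apply: (@le_trans _ _ (`|a| * `|b| * (`|a| / `|b|))).
  by rewrite ler_wpM2l ?mulr_ge0// ltW// ln_sublinear// divr_gt0.
rewrite (_ : _ * _ = `|a| ^+ 2); last by field; rewrite gt_eqF.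
by rewrite real_normK ?num_real// lerDl sqr_ge0.
Qed.

End Entropy.

Section SquareSummable.
Context (R : realType).
Implicit Types (a b y v : nat -> R).

(** The Cauchy-Schwarz inequality, from v y <= (M v^2 + M^-1 y^2) / 2. *)
Lemma unit_ball_pairing_le y M : 0 <= M ->
  (forall n, \sum_(0 <= i < n) y i ^+ 2 <= M ^+ 2) ->
  forall n v, \sum_(0 <= i < n) v i ^+ 2 <= 1 ->
    `|\sum_(0 <= i < n) v i * y i| <= M.
Proof.
move=> M0 yM n v v1.
wlog {M0} M0 : M yM / 0 < M.
  move=> h; apply/ler_addgt0Pr => e e0; apply: h => [k|]; last exact: ltr_wpDl.
  by apply: le_trans (yM k) _; rewrite lerXn2r ?nnegrE ?lerDl; lra.
have := yM n; set Y := \sum_(_ <= _ < _) _ => YM.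
have half s : s ^+ 2 = 1 -> s * \sum_(0 <= i < n) v i * y i <= M.
  move=> s1.
  apply: (@le_trans _ _ (M / 2 * \sum_(0 <= i < n) v i ^+ 2 + M^-1 / 2 * Y)).
    rewrite /Y !mulr_sumr -big_split /=; apply: ler_sum => i _.
    have : 0 <= M^-1 / 2 * (M * v i - s * y i) ^+ 2.
      by rewrite mulr_ge0 ?sqr_ge0// divr_ge0// invr_ge0 ltW.
    rewrite (_ : _ * _ ^+ 2 = M / 2 * v i ^+ 2 + s ^+ 2 * (M^-1 / 2 * y i ^+ 2)
       - s * (v i * y i)); first by rewrite s1; lra.
    by field; rewrite gt_eqF.
  have h1 : M / 2 * \sum_(0 <= i < n) v i ^+ 2 <= M / 2.
    by rewrite ler_piMr// divr_ge0// ltW.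
  have h2 : M^-1 / 2 * Y <= M^-1 / 2 * M ^+ 2.
    by rewrite ler_wpM2l// divr_ge0// invr_ge0 ltW.
  have h3 : M^-1 / 2 * M ^+ 2 = M / 2 by field; rewrite gt_eqF.
  lra.
rewrite ler_norml; have := half 1 (expr1n _ _).
have : (-1 : R) ^+ 2 = 1 by rewrite sqrrN expr1n.
move=> /half; lra.
Qed.

Lemma unit_ball_pairing_ge y M :
  (forall n v, \sum_(0 <= i < n) v i ^+ 2 <= 1 ->
    `|\sum_(0 <= i < n) v i * y i| <= M) ->
  forall n, \sum_(0 <= i < n) y i ^+ 2 <= M ^+ 2.
Proof.
move=> yM n; set S := \sum_(_ <= _ < _) _.
have S0 : 0 <= S by apply: sumr_ge0 => i _; exact: sqr_ge0.
have [->|Sn0] := eqVneq S 0; first exact: sqr_ge0.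
have r0 : 0 < Num.sqrt S by rewrite sqrtr_gt0 lt_neqAle eq_sym Sn0.
have rr : Num.sqrt S ^+ 2 = S by exact: sqr_sqrtr.
have rn0 : Num.sqrt S != 0 by rewrite gt_eqF.
have := yM n (fun i => (Num.sqrt S)^-1 * y i).
under eq_bigr do rewrite exprMn.
rewrite -mulr_sumr -/S exprVn rr mulVf// lexx => /(_ isT).
under eq_bigr do rewrite -mulrA -expr2.
rewrite -mulr_sumr -/S -{2}rr expr2 mulKf// => h.
rewrite -[leLHS]rr lerXn2r ?nnegrE ?(ltW r0)//.
  exact: le_trans h.
exact: le_trans (ler_norm _) h.
Qed.

Definition square_summable a :=
  exists M, forall n, \sum_(0 <= i < n) a i ^+ 2 <= M.

Definition dot a b : R := limn (series (fun i => a i * b i)).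

Lemma is_cvg_series_sqr a : square_summable a ->
  cvgn (series (fun i => a i ^+ 2)).
Proof.
move=> [M aM]; apply: nondecreasing_is_cvgn.
  apply/nondecreasing_seqP => n.
  by rewrite /series /= big_nat_recr//= lerDl sqr_ge0.
by exists M => _ [n _ <-]; exact: aM.
Qed.

Lemma is_cvg_dot a b : square_summable a -> square_summable b ->
  cvgn (series (fun i => a i * b i)).
Proof.
move=> sa sb; apply: normed_cvg.
apply: (@series_le_cvg _ _ (fun i => a i ^+ 2 + b i ^+ 2)) => [i|i|i|].
- exact: normr_ge0.
- by rewrite addr_ge0 ?sqr_ge0.
- rewrite /= normrM -[a i ^+ 2]real_normK ?num_real//.
  rewrite -[b i ^+ 2]real_normK ?num_real//.
  have := sqr_ge0 (`|a i| - `|b i|); have := sqr_ge0 (`|a i| + `|b i|); nra.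
- have := is_cvg_seriesD (is_cvg_series_sqr sa) (is_cvg_series_sqr sb).
  by apply.
Qed.

Lemma dotC a b : dot a b = dot b a.
Proof. by rewrite /dot; under eq_fun do rewrite mulrC. Qed.

Lemma dotD a a' b :
  square_summable a -> square_summable a' -> square_summable b ->
  dot (fun i => a i + a' i) b = dot a b + dot a' b.
Proof.
move=> sa sa' sb; rewrite /dot -lim_seriesD; [|exact: is_cvg_dot..].
by congr (limn (series _)); apply/funext => i; rewrite mulrDl.
Qed.

Lemma dotZ c a b : square_summable a -> square_summable b ->
  dot (fun i => c * a i) b = c * dot a b.
Proof.
move=> sa sb; rewrite /dot -[RHS](lim_seriesZ c (is_cvg_dot sa sb)).
by congr (limn (series _)); apply/funext => i; rewrite -mulrA.
Qed.

(** Stated on the sums and differences themselves so that it applies without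
    expanding the bilinear form. *)
Lemma dot_parallelogram a b
    (p := fun i => a i + b i) (q := fun i => a i - b i) :
  square_summable a -> square_summable b ->
  square_summable p -> square_summable q ->
  dot p p + dot q q = 2 * (dot a a + dot b b).
Proof.
move=> sa sb sp sq.
have ca := is_cvg_dot sa sa; have cb := is_cvg_dot sb sb.
rewrite /dot -(lim_seriesD ca cb).
rewrite -(lim_seriesD (is_cvg_dot sp sp) (is_cvg_dot sq sq)).
rewrite -[RHS](lim_seriesZ 2 (is_cvg_seriesD ca cb)).
congr (limn (series _)); apply/funext => i.
rewrite -[LHS]/((a i + b i) * (a i + b i) + (a i - b i) * (a i - b i)).
by rewrite -[RHS]/(2 * (a i * a i + b i * b i)); ring.
Qed.

Lemma dot_self_le a M :
  (forall n, \sum_(0 <= i < n) a i ^+ 2 <= M) -> dot a a <= M.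
Proof.
move=> aM; apply: limr_le; first by apply: is_cvg_dot; exists M.
by apply: nearW => n; exact: aM.
Qed.

Lemma dot_self_ge a n : square_summable a ->
  \sum_(0 <= i < n) a i ^+ 2 <= dot a a.
Proof.
move=> sa; apply: (nondecreasing_cvgn_le _ (is_cvg_dot sa sa)).
apply/nondecreasing_seqP => k.
by rewrite /series /= big_nat_recr//= lerDl -expr2 sqr_ge0.
Qed.

End SquareSummable.

(** * The twisted sum and its slices *)

(** The three coordinates y, x, b of a triple, in this order. *)
Variant layer := Fiber | Middle | Base.

Section KaltonPeck.
Context (R : realType).

Definition layer_functional (k : layer) (n : nat) (v : nat -> R) :
    seq (layer * nat * R) :=
  [seq ((k, i), v i) | i <- index_iota 0 n].

Lemma pairing_layer k n v (w : layer * nat -> R) :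
  pairing (layer_functional k n v) w = \sum_(0 <= i < n) v i * w (k, i).
Proof. by rewrite /pairing big_map. Qed.

(** Pairing with the lift (omega(v), v) under the symplectic duality of the
    Kalton-Peck space with itself. *)
Definition twisted_functional n v :=
  layer_functional Fiber n v ++
  layer_functional Middle n (fun i => - entropy (v i)).

Lemma pairing_twisted n v w :
  pairing (twisted_functional n v) w =
  \sum_(0 <= i < n) (v i * w (Fiber, i) - entropy (v i) * w (Middle, i)).
Proof.
transitivity (pairing (layer_functional Fiber n v) w +
  pairing (layer_functional Middle n (fun i => - entropy (v i))) w).
  exact: big_cat.
rewrite !pairing_layer -big_split /=.
by apply: eq_bigr => i _; rewrite mulNr.
Qed.

Definition kalton_peck_functionals : set (seq (layer * nat * R)) :=
  [set g | exists n v, \sum_(0 <= i < n) v i ^+ 2 <= 1 /\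
    [\/ g = layer_functional Base n v, g = layer_functional Middle n v |
        g = twisted_functional n v]].

Definition unit_vector (i j : nat) : R := (j == i)%:R.

Lemma sum_unit_vector i (F : nat -> R) :
  (forall j, j != i -> F j = 0) -> \sum_(0 <= j < i.+1) F j = F i.
Proof.
move=> F0; rewrite big_nat_recr//= big1_seq ?add0r// => j /andP[_].
by rewrite mem_index_iota => /andP[_ ji]; rewrite F0// ltn_eqF.
Qed.

Lemma kalton_peck_coordinate p :
  exists2 g, kalton_peck_functionals g & forall w, pairing g w = w p.
Proof.
have e1 i : \sum_(0 <= j < i.+1) unit_vector i j ^+ 2 <= 1.
  rewrite sum_unit_vector ?/unit_vector ?eqxx ?expr1n// => j /negbTE ->.
  by rewrite expr0n.
have eE k i (w : layer * nat -> R) :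
    pairing (layer_functional k i.+1 (unit_vector i)) w = w (k, i).
  rewrite pairing_layer sum_unit_vector /unit_vector ?eqxx ?mul1r//.
  by move=> j /negbTE ->; rewrite mul0r.
case: p => -[] i.
- exists (twisted_functional i.+1 (unit_vector i)).
    by exists i.+1, (unit_vector i); split=> //; apply: Or33.
  move=> w; rewrite pairing_twisted sum_unit_vector /unit_vector ?eqxx.
    by rewrite mul1r entropy_sign ?normr1// mul0r subr0.
  by move=> j /negbTE ->; rewrite entropy0 !mul0r subr0.
- exists (layer_functional Middle i.+1 (unit_vector i)) => //.
  by exists i.+1, (unit_vector i); split=> //; apply: Or32.
- exists (layer_functional Base i.+1 (unit_vector i)) => //.
  by exists i.+1, (unit_vector i); split=> //; apply: Or31.
Qed.

Definition kalton_peck_family := NormingFamily kalton_peck_coordinate.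

Definition twisted_sum : completeNormedModType R :=
  normed_by kalton_peck_family.

Implicit Types u : twisted_sum.

Definition layer_val (k : layer) u (i : nat) : R := family_val u (k, i).

Lemma layer_val_scalar k i : scalar (layer_val k ^~ i).
Proof. by move=> a u v; rewrite /layer_val family_valD family_valZ. Qed.

Lemma layer_val_lipschitz k i u v :
  `|layer_val k u i - layer_val k v i| <= `|u - v|.
Proof.
by have := coordinate_le_norm (u - v) (k, i); rewrite family_valB.
Qed.

Lemma twisted_sum_ext u v :
  (forall k i, layer_val k u i = layer_val k v i) -> u = v.
Proof. by move=> uv; apply: val_inj; apply/funext => -[k i]; exact: uv. Qed.

Lemma twisted_sum_norm_le u M : 0 <= M ->
  (forall n v, \sum_(0 <= i < n) v i ^+ 2 <= 1 ->
    [/\ `|\sum_(0 <= i < n) v i * layer_val Base u i| <= M,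
        `|\sum_(0 <= i < n) v i * layer_val Middle u i| <= M &
        `|\sum_(0 <= i < n) (v i * layer_val Fiber u i -
           entropy (v i) * layer_val Middle u i)| <= M]) ->
  `|u| <= M.
Proof.
move=> M0 uM; apply: norm_le_pairing => // g [n [v [/uM[b m f]]]].
by case=> ->; rewrite ?pairing_layer ?pairing_twisted.
Qed.

Lemma exists_with_layers (f m b : nat -> R) M : 0 <= M ->
  (forall n v, \sum_(0 <= i < n) v i ^+ 2 <= 1 ->
    [/\ `|\sum_(0 <= i < n) v i * b i| <= M,
        `|\sum_(0 <= i < n) v i * m i| <= M &
        `|\sum_(0 <= i < n) (v i * f i - entropy (v i) * m i)| <= M]) ->
  exists u, [/\ layer_val Fiber u = f, layer_val Middle u = m,
                layer_val Base u = b & `|u| <= M].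
Proof.
move=> M0 wM.
pose w (p : layer * nat) : R :=
  match p.1 with Fiber => f p.2 | Middle => m p.2 | Base => b p.2 end.
have wG : w \in bounded_on kalton_peck_family.
  rewrite inE; exists M => g [n [v [/wM[bM mM fM]]]].
  by case=> ->; rewrite ?pairing_layer ?pairing_twisted.
exists (NormedBy wG : twisted_sum); split=> //.
exact: twisted_sum_norm_le.
Qed.

Lemma base_sqr_sum_le u n :
  \sum_(0 <= i < n) layer_val Base u i ^+ 2 <= `|u| ^+ 2.
Proof.
apply: unit_ball_pairing_ge => {}n v v1; rewrite -pairing_layer.
apply: (@pairing_le_norm _ _ kalton_peck_family u).
by exists n, v; split=> //; apply: Or31.
Qed.

Lemma fiber_sqr_sum_le u n : (forall i, layer_val Middle u i = 0) ->
  \sum_(0 <= i < n) layer_val Fiber u i ^+ 2 <= `|u| ^+ 2.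
Proof.
move=> m0; apply: unit_ball_pairing_ge => {}n v v1.
have -> : \sum_(0 <= i < n) v i * layer_val Fiber u i =
    pairing (twisted_functional n v) (family_val u).
  rewrite pairing_twisted; apply: eq_bigr => i _.
  by have := m0 i; rewrite /layer_val => ->; rewrite mulr0 subr0.
apply: (@pairing_le_norm _ _ kalton_peck_family u).
by exists n, v; split=> //; apply: Or33.
Qed.

Lemma norm_le_of_middle0 u M : 0 <= M -> (forall i, layer_val Middle u i = 0) ->
  (forall n, \sum_(0 <= i < n) layer_val Fiber u i ^+ 2 <= M ^+ 2) ->
  (forall n, \sum_(0 <= i < n) layer_val Base u i ^+ 2 <= M ^+ 2) ->
  `|u| <= M.
Proof.
move=> M0 m0 fM bM; apply: twisted_sum_norm_le => // n v v1; split.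
- exact: unit_ball_pairing_le.
- by rewrite big1 ?normr0// => i _; rewrite m0 mulr0.
- under eq_bigr => i _ do rewrite m0 mulr0 subr0.
  exact: unit_ball_pairing_le.
Qed.

Lemma exists_fiber (y : nat -> R) M : 0 <= M ->
  (forall n, \sum_(0 <= i < n) y i ^+ 2 <= M ^+ 2) ->
  exists u, [/\ layer_val Fiber u = y, layer_val Middle u = (fun=> 0),
                layer_val Base u = (fun=> 0) & `|u| <= M].
Proof.
move=> M0 yM; apply: exists_with_layers => // n v v1; split.
- by rewrite big1 ?normr0// => i _; rewrite mulr0.
- by rewrite big1 ?normr0// => i _; rewrite mulr0.
- under eq_bigr => i _ do rewrite mulr0 subr0.
  exact: unit_ball_pairing_le.
Qed.

(** The twisted functional at (t omega(x), t x) is t times the sum of the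
    antisymmetric expressions omega(x_i) v_i - x_i omega(v_i). *)
Lemma entropy_lift_le (x : nat -> R) t n v : 0 <= t ->
  \sum_(0 <= i < n) x i ^+ 2 <= 1 -> \sum_(0 <= i < n) v i ^+ 2 <= 1 ->
  `|\sum_(0 <= i < n) (v i * (t * entropy (x i)) - entropy (v i) * (t * x i))|
    <= 2 * t.
Proof.
move=> t0 x1 v1; apply: le_trans (ler_norm_sum _ _ _) _.
apply: (@le_trans _ _ (\sum_(0 <= i < n) t * (x i ^+ 2 + v i ^+ 2))).
  apply: ler_sum => i _.
  rewrite (_ : _ - _ = t * (entropy (x i) * v i - x i * entropy (v i))).
    by rewrite normrM ger0_norm// ler_wpM2l// entropy_antisymmetric_le.
  by ring.
by rewrite -mulr_sumr big_split /= mulrC ler_wpM2r// lerD.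
Qed.

Lemma exists_entropy_lift (x : nat -> R) t : 0 <= t ->
  (forall n, \sum_(0 <= i < n) x i ^+ 2 <= 1) ->
  exists u, [/\ layer_val Fiber u = (fun i => t * entropy (x i)),
                layer_val Middle u = (fun i => t * x i),
                layer_val Base u = (fun=> 0) & `|u| <= 2 * t].
Proof.
move=> t0 x1; apply: exists_with_layers => [|n v v1]; first by rewrite mulr_ge0.
split; last exact: entropy_lift_le.
- by rewrite big1 ?normr0 ?mulr_ge0// => i _; rewrite mulr0.
- under eq_bigr do rewrite mulrCA.
  rewrite -mulr_sumr normrM ger0_norm// mulrC ler_wpM2r//.
  apply: (@le_trans _ _ 1); last by lra.
  by apply: unit_ball_pairing_le => // k; rewrite expr1n.
Qed.

Lemma exists_base (x : nat -> R) :
  (forall n, \sum_(0 <= i < n) x i ^+ 2 <= 1) ->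
  exists u, [/\ layer_val Fiber u = (fun=> 0), layer_val Middle u = (fun=> 0),
                layer_val Base u = x & `|u| <= 1].
Proof.
move=> x1; apply: exists_with_layers => // n v v1; split.
- by apply: unit_ball_pairing_le => // k; rewrite expr1n.
- by rewrite big1 ?normr0// => i _; rewrite mulr0.
- by rewrite big1 ?normr0// => i _; rewrite !mulr0 subr0.
Qed.

Definition slice_form t i u : R :=
  layer_val Middle u i - t * layer_val Base u i.

Lemma slice_form_scalar t i : scalar (slice_form t i).
Proof.
move=> a u v; rewrite /slice_form (layer_val_scalar Middle i a u v).
by rewrite (layer_val_scalar Base i a u v) /=; ring.
Qed.

Definition slice_set t : set twisted_sum :=
  [set u | forall i, layer_val Middle u i = t * layer_val Base u i].

Lemma slice_setE t : slice_set t = [set u | forall i, slice_form t i u = 0].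
Proof.
apply/seteqP; split=> u /= h i; first by rewrite /slice_form h subrr.
exact/subr0_eq/h.
Qed.

Lemma slice_submod_closed t : submod_closed [in slice_set t].
Proof.
rewrite slice_setE.
exact: (joint_kernel_submod_closed (slice_form_scalar t)).
Qed.

(** The defining forms have Lipschitz constant at most 1 + |t|; they are
    rescaled to be 1-Lipschitz. *)
Lemma slice_closed t : closed (slice_set t).
Proof.
pose f i u := (1 + `|t|)^-1 * slice_form t i u.
have t0 : 0 < 1 + `|t| by rewrite ltr_wpDr.
have -> : slice_set t = [set u | forall i, f i u = 0].
  rewrite slice_setE; apply/seteqP; split=> u /= h i.
    by rewrite /f h mulr0.
  by have /eqP := h i; rewrite mulf_eq0 invr_eq0 gt_eqF//= => /eqP.
apply: lipschitz_joint_kernel_closed => i u v.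
rewrite -mulrBr normrM normfV (ger0_norm (ltW t0)) ler_pdivrMl//.
rewrite /slice_form (_ : _ - _ = (layer_val Middle u i - layer_val Middle v i) -
  t * (layer_val Base u i - layer_val Base v i)); last by ring.
apply: le_trans (ler_normB _ _) _; rewrite mulrDl mul1r normrM lerD//.
  exact: layer_val_lipschitz.
by rewrite ler_wpM2l// layer_val_lipschitz.
Qed.

Lemma exists_fiber_basis : exists v : nat -> twisted_sum, forall j,
  [/\ (forall i, layer_val Fiber (v j) i = (i == j)%:R),
      (forall i, layer_val Middle (v j) i = 0) &
      (forall i, layer_val Base (v j) i = 0)].
Proof.
suff /choice[v vE] : forall j, exists u : twisted_sum,
    [/\ (forall i, layer_val Fiber u i = (i == j)%:R),
        (forall i, layer_val Middle u i = 0) &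
        (forall i, layer_val Base u i = 0)] by exists v.
move=> j.
have [||u [uf um ub _]] := @exists_fiber (unit_vector j) 1 => //.
  move=> n; rewrite expr1n; have [jn|nj] := ltnP j n.
    rewrite (big_cat_nat (n := j.+1))//= sum_unit_vector.
      rewrite /unit_vector eqxx expr1n big1_seq ?addr0// => k /andP[_].
      by rewrite mem_index_iota => /andP[jk _]; rewrite gtn_eqF// expr0n.
    by move=> k /negbTE kj; rewrite /unit_vector kj expr0n.
  rewrite big1_seq// => k /andP[_]; rewrite mem_index_iota => /andP[_ kn].
  by rewrite /unit_vector ltn_eqF ?expr0n// (leq_trans kn).
by exists u; rewrite uf um ub.
Qed.

Lemma slice_infinite_dimensional t : infinite_dimensional (slice_set t).
Proof.
have [v vE] := exists_fiber_basis.
apply: (@biorthogonal_infinite_dimensional _ _ _ v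
  (fun i => layer_val Fiber ^~ i)).
- by move=> i; exact: layer_val_scalar.
- by move=> i j; have [-> _ _] := vE j.
- by move=> j i; have [_ -> ->] := vE j; rewrite mulr0.
Qed.

Definition slice t : banach_subspace twisted_sum :=
  BanachSubspace (slice_submod_closed t) (@slice_closed t)
    (@slice_infinite_dimensional t).

Lemma gap_slice_le t : 0 <= t -> gap (slice 0) (slice t) <= 2 * t.
Proof.
move=> t0; apply: gap_le => [|u um u1|u um u1]; first by rewrite mulr_ge0.
all: have [||d [df dm db dn]] :=
  @exists_entropy_lift (layer_val Base u) t => //.
1, 3: by move=> n; apply: le_trans (base_sqr_sum_le u n) _; rewrite u1 expr1n.
- exists (u + d); last by rewrite opprD addNKr normrN.
  move=> i; rewrite /layer_val !family_valD.
  have := um i; rewrite /= mul0r /layer_val /= => um0.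
  have := congr1 (@^~ i) dm; have := congr1 (@^~ i) db; rewrite /layer_val /=.
  move=> db0 dm0; rewrite [LHS]/GRing.add /= um0 dm0.
  by rewrite [in RHS]/GRing.add /= db0 addr0 add0r.
- exists (u - d); last by rewrite opprD opprK addNKr.
  move=> i; rewrite /layer_val !family_valB mul0r.
  have := um i; have := congr1 (@^~ i) dm; rewrite /layer_val /= => dm0 um0.
  by rewrite [LHS]/GRing.add /= /GRing.opp /= dm0 um0 subrr.
Qed.

End KaltonPeck.

Section SpaceOf.
Context (R : realType) (X : completeNormedModType R) (Y : banach_subspace X).
Implicit Types u v : space_of Y.

Lemma space_valD u v : space_val (u + v) = space_val u + space_val v.
Proof. by rewrite -[LHS]/(val (u + v)) raddfD. Qed.

Lemma space_valZ a u : space_val (a *: u) = a *: space_val u.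
Proof. by rewrite -[LHS]/(val (a *: u)) linearZ. Qed.

Lemma space_valB u v : space_val (u - v) = space_val u - space_val v.
Proof. by rewrite -[LHS]/(val (u - v)) raddfB. Qed.

Lemma norm_space_val u : `|u| = `|space_val u|.
Proof. by []. Qed.

End SpaceOf.

Section SliceLayers.
Context (R : realType) (t : R).
Let E : completeNormedModType R := space_of (slice t).
Implicit Types u v : E.

Definition slice_val k u : nat -> R := layer_val k (space_val u).

Lemma slice_val_scalar k i : scalar (slice_val k ^~ i).
Proof.
move=> a u v; rewrite /slice_val space_valD space_valZ.
exact: (layer_val_scalar k i).
Qed.

Lemma slice_valD k u v :
  slice_val k (u + v) = (fun i => slice_val k u i + slice_val k v i).
Proof.
apply/funext => i; have := slice_val_scalar k i 1 u v.
by rewrite scale1r mul1r.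
Qed.

Lemma slice_valZ k a u :
  slice_val k (a *: u) = (fun i => a * slice_val k u i).
Proof.
apply/funext => i.
have := scalar_sumZ [:: tt] (fun=> a) (fun=> u) (slice_val_scalar k i).
by rewrite !big_seq1.
Qed.

Lemma slice_val_lipschitz k i u v :
  `|slice_val k u i - slice_val k v i| <= `|u - v|.
Proof.
by rewrite norm_space_val space_valB; exact: layer_val_lipschitz.
Qed.

Lemma slice_middle u i : slice_val Middle u i = t * slice_val Base u i.
Proof. exact: (set_mem (space_valP u)). Qed.

Lemma slice_ext u v : slice_val Fiber u = slice_val Fiber v ->
  slice_val Base u = slice_val Base v -> u = v.
Proof.
move=> uvf uvb; apply: val_inj; apply: twisted_sum_ext => -[] i.
- exact: (congr1 (@^~ i) uvf).
- by rewrite -[LHS]/(slice_val Middle u i) -[RHS]/(slice_val Middle v i)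
    !slice_middle uvb.
- exact: (congr1 (@^~ i) uvb).
Qed.

Lemma slice_base_summable u : square_summable (slice_val Base u).
Proof. by exists (`|u| ^+ 2) => n; exact: base_sqr_sum_le. Qed.

End SliceLayers.

(** * The Hilbertian slice *)

Section SubprojectiveSlice.
Context (R : realType).
Let E : completeNormedModType R := space_of (slice (0 : R)).
Implicit Types u v : E.

Let middle0 u i : layer_val Middle (space_val u) i = 0.
Proof. by rewrite -[LHS]/(slice_val Middle u i) slice_middle mul0r. Qed.

Let fiber_summable u : square_summable (slice_val Fiber u).
Proof. by exists (`|u| ^+ 2) => n; apply: fiber_sqr_sum_le; exact: middle0. Qed.

Let form u v := dot (slice_val Fiber u) (slice_val Fiber v) +
  dot (slice_val Base u) (slice_val Base v).

Lemma subprojective_slice0 : subprojective E.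
Proof.
move=> W; exists W; split=> //.
have fs := fiber_summable; have bs := @slice_base_summable R 0.
apply: (@closed_subspace_complemented _ E form 2).
- by move=> u v; rewrite /form dotC (dotC (slice_val Base u)).
- by move=> u u' v; rewrite /form !slice_valD !dotD//; ring.
- by move=> a u v; rewrite /form !slice_valZ !dotZ//; ring.
- move=> u; rewrite mulrDl mul1r lerD// dot_self_le// => n.
    exact: fiber_sqr_sum_le (middle0 u).
  exact: base_sqr_sum_le.
- move=> u.
  have f0 : 0 <= dot (slice_val Fiber u) (slice_val Fiber u).
    by have := dot_self_ge 0 (fs u); rewrite big_nil.
  have b0 : 0 <= dot (slice_val Base u) (slice_val Base u).
    by have := dot_self_ge 0 (bs u); rewrite big_nil.
  have r0 : 0 <= form u u by rewrite addr_ge0.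
  rewrite -[leRHS]sqr_sqrtr// lerXn2r ?nnegrE ?sqrtr_ge0//.
  apply: norm_le_of_middle0 => [||n|n].
  - exact: sqrtr_ge0.
  - exact: middle0.
  - rewrite sqr_sqrtr//.
    by apply: le_trans (dot_self_ge n (fs u)) _; rewrite lerDl.
  - rewrite sqr_sqrtr//.
    by apply: le_trans (dot_self_ge n (bs u)) _; rewrite lerDr.
Qed.

End SubprojectiveSlice.

(** * The fiber of a slice *)

Section NonSubprojectiveSlice.
Context (R : realType) (t : R).
Let E : completeNormedModType R := space_of (slice t).
Implicit Types u v : E.

Definition fiber : set E := [set u | forall i, slice_val Base u i = 0].

Let middle0 u i : fiber u -> layer_val Middle (space_val u) i = 0.
Proof.
by move=> u0; rewrite -[LHS]/(slice_val Middle u i) slice_middle u0 mulr0.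
Qed.

Lemma fiber_submod_closed : submod_closed [in fiber].
Proof.
apply: (@joint_kernel_submod_closed _ E _ (fun i u => slice_val Base u i)) => i.
exact: slice_val_scalar.
Qed.

Lemma fiber_closed : closed fiber.
Proof.
apply: (@lipschitz_joint_kernel_closed _ E _ (fun i u => slice_val Base u i)).
exact: slice_val_lipschitz.
Qed.

Lemma exists_slice_with_layers (f b : nat -> R) (w : twisted_sum R) :
  layer_val Fiber w = f -> layer_val Middle w = (fun i => t * b i) ->
  layer_val Base w = b ->
  exists u, [/\ slice_val Fiber u = f, slice_val Base u = b & `|u| = `|w|].
Proof.
move=> wf wm wb.
have wt : w \in subspace_set (slice t) by rewrite inE /= => i; rewrite wm wb.
by exists (SpaceOf wt).
Qed.

Lemma exists_in_fiber (y : nat -> R) M : 0 <= M ->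
  (forall n, \sum_(0 <= i < n) y i ^+ 2 <= M ^+ 2) ->
  exists u, [/\ slice_val Fiber u = y, fiber u & `|u| <= M].
Proof.
move=> M0 yM; have [w [wf wm wb wn]] := exists_fiber M0 yM.
have [|u [uf ub un]] := exists_slice_with_layers wf _ wb.
  by rewrite wm; apply/funext => i; rewrite mulr0.
by exists u; split; rewrite ?un //; move=> i; rewrite ub.
Qed.

Lemma exists_lift (x : nat -> R) : 0 <= t ->
  (forall n, \sum_(0 <= i < n) x i ^+ 2 <= 1) ->
  exists u, [/\ slice_val Fiber u = (fun i => t * entropy (x i)),
                slice_val Base u = x & `|u| <= 2 * t + 1].
Proof.
move=> t0 x1; have [d [df dm db dn]] := exists_entropy_lift t0 x1.
have [b [bf bm bb bn]] := exists_base x1.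
have addE k :
    layer_val k (d + b) = (fun i => layer_val k d i + layer_val k b i).
  apply/funext => i; have := layer_val_scalar k i 1 d b.
  by rewrite scale1r mul1r.
have [|||u [uf ub un]] := @exists_slice_with_layers
    (fun i => t * entropy (x i)) x (d + b).
- by rewrite addE df bf; apply/funext => i; rewrite addr0.
- by rewrite addE dm bm; apply/funext => i; rewrite addr0.
- by rewrite addE db bb; apply/funext => i; rewrite add0r.
exists u; split=> //; rewrite un.
by apply: le_trans (ler_normD _ _) _; rewrite lerD.
Qed.

Lemma fiber_infinite_dimensional : infinite_dimensional fiber.
Proof.
have [v vE] := exists_fiber_basis R.
have /choice[w wE] : forall j, exists u, fiber u /\
    forall i, slice_val Fiber u i = (i == j)%:R.
  move=> j; have [vf vm vb] := vE j.
  have [|u [uf ub _]] := @exists_slice_with_layers _ _ (v j) erefl _ erefl.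
    by apply/funext => i; rewrite vm vb mulr0.
  by exists u; split => i; rewrite ?uf ?ub.
apply: (@biorthogonal_infinite_dimensional _ _ _ w
  (fun i u => slice_val Fiber u i)) => [i|i j|j].
- exact: slice_val_scalar.
- exact: (wE j).2.
- exact: (wE j).1.
Qed.

Definition fiber_subspace : banach_subspace E :=
  BanachSubspace fiber_submod_closed fiber_closed fiber_infinite_dimensional.

Lemma slice_fiber_sqr_sum_le u n : fiber u ->
  \sum_(0 <= i < n) slice_val Fiber u i ^+ 2 <= `|u| ^+ 2.
Proof. by move=> u0; apply: fiber_sqr_sum_le => i; exact: middle0. Qed.

Lemma slice_fiber_norm_le u M : 0 <= M -> fiber u ->
  (forall n, \sum_(0 <= i < n) slice_val Fiber u i ^+ 2 <= M ^+ 2) ->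
  `|u| <= M.
Proof.
move=> M0 u0 uM; apply: norm_le_of_middle0 => // [i|n]; first exact: middle0.
rewrite big1 ?sqr_ge0// => i _.
by rewrite -[layer_val _ _ _]/(slice_val Base u i) u0 expr0n.
Qed.

Lemma fiber_summable u : fiber u -> square_summable (slice_val Fiber u).
Proof.
by move=> u0; exists (`|u| ^+ 2) => n; exact: slice_fiber_sqr_sum_le.
Qed.

Lemma fiber_norm_sqr u : fiber u ->
  `|u| ^+ 2 = dot (slice_val Fiber u) (slice_val Fiber u).
Proof.
move=> u0; have us := fiber_summable u0; apply/le_anti/andP; split; last first.
  by apply: dot_self_le => n; exact: slice_fiber_sqr_sum_le.
have d0 : 0 <= dot (slice_val Fiber u) (slice_val Fiber u).
  by have := dot_self_ge 0 us; rewrite big_nil.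
rewrite -[leRHS]sqr_sqrtr// lerXn2r ?nnegrE ?sqrtr_ge0//.
apply: slice_fiber_norm_le => // n; rewrite sqr_sqrtr//; exact: dot_self_ge.
Qed.

Lemma fiber_linear a u v : fiber u -> fiber v -> fiber (a *: u + v).
Proof. exact: (@subspace_set_linear _ _ fiber_subspace). Qed.

Lemma fiber_parallelogram u v : fiber u -> fiber v ->
  2 * (`|u| ^+ 2 + `|v| ^+ 2) <= `|u + v| ^+ 2 + `|u - v| ^+ 2.
Proof.
move=> u0 v0.
have uv0 : fiber (u + v) by rewrite -[u]scale1r; exact: fiber_linear.
have vu0 : fiber (u - v) by rewrite addrC -scaleN1r; exact: fiber_linear.
have us := fiber_summable u0; have vs := fiber_summable v0.
have uvE : slice_val Fiber (u - v) =
    (fun i => slice_val Fiber u i - slice_val Fiber v i).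
  by rewrite -scaleN1r slice_valD slice_valZ; apply/funext => i; rewrite mulN1r.
have uvs := fiber_summable uv0; have vus := fiber_summable vu0.
rewrite !fiber_norm_sqr//.
rewrite slice_valD in uvs *; rewrite uvE in vus *.
by rewrite dot_parallelogram.
Qed.

(** Gliding hump: since V is infinite dimensional, it has a unit vector v
    vanishing before N, and u is obtained from v by cutting off a small tail. *)
Lemma exists_block (V : banach_subspace E) (d : R) (N : nat) :
  subspace_set V `<=` fiber -> 0 < d ->
  exists (v u : E) (N' : nat),
    [/\ subspace_set V v, `|v| = 1, `|v - u| <= d, fiber u & `|u| <= 1] /\
    [/\ (N <= N')%N & forall i, ~~ (N <= i < N')%N -> slice_val Fiber u i = 0].
Proof.
move=> VF d0.
have [v0 [Vv0 v0n v0k]] := subspace_nonzero_in_kernels V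
  (fun i : 'I_N => slice_val_scalar (t := t) Fiber i).
pose v := `|v0|^-1 *: v0.
have Vv : subspace_set V v by exact: subspace_setZ.
have v1 : `|v| = 1 by rewrite normrZ normfV normr_id mulVf// normr_eq0.
have Fv := VF _ Vv.
pose a := slice_val Fiber v.
have aN i : (i < N)%N -> a i = 0.
  by move=> iN; rewrite /a slice_valZ (v0k (Ordinal iN)) mulr0.
have a1 n : \sum_(0 <= i < n) a i ^+ 2 <= 1.
  by have := slice_fiber_sqr_sum_le n Fv; rewrite v1 expr1n.
have sa : square_summable a by exact: fiber_summable.
have [n0 _ n0P] : \forall n \near \oo,
    `|dot a a - \sum_(0 <= i < n) a i ^+ 2| <= d ^+ 2.
  have /cvgrPdist_le/(_ (d ^+ 2)) := is_cvg_dot sa sa.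
  by apply; rewrite exprn_gt0.
pose N' := maxn N n0.
pose y i := if (N <= i < N')%N then a i else 0.
have [||u [uf uF un]] := @exists_in_fiber y 1 => //.
  move=> n; rewrite expr1n; apply: le_trans (a1 n); apply: ler_sum => i _.
  by rewrite /y; case: ifP => // _; rewrite expr0n sqr_ge0.
exists v, u, N'; split; split=> //; last 2 first.
- exact: leq_maxl.
- by move=> i iN; rewrite uf /y (negbTE iN).
apply: slice_fiber_norm_le; first exact: ltW.
  by rewrite addrC -scaleN1r; exact: fiber_linear.
have vuE i : slice_val Fiber (v - u) i = if (i < N')%N then 0 else a i.
  rewrite -scaleN1r slice_valD (slice_valZ _ (-1) u) uf /y -/a.
  have [Ni|iN] /= := leqP N i; case: ltnP => iN' //=; rewrite ?mulr0 ?addr0//.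
  - by rewrite mulN1r subrr.
  - exact: aN.
move=> n; have [nN|/ltnW nN] := leqP n N'.
  rewrite big1_seq ?sqr_ge0// => i /andP[_].
  rewrite mem_index_iota => /andP[_ ni].
  by rewrite vuE (leq_trans ni nN) expr0n.
rewrite (big_cat_nat (n := N'))//= big1_seq ?add0r => [|i /andP[_]]; last first.
  by rewrite mem_index_iota => /andP[_ iN]; rewrite vuE iN expr0n.
rewrite (eq_big_nat _ _ (F2 := fun i => a i ^+ 2)); last first.
  by move=> i /andP[Ni _]; rewrite vuE ltnNge Ni.
have := n0P N' (leq_maxr _ _); rewrite /= => /(le_trans (ler_norm _)).
have := dot_self_ge n sa; rewrite (big_cat_nat (n := N') (p := n))//=; lra.
Qed.

Lemma exists_blocks (V : banach_subspace E) (d : R) :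
  subspace_set V `<=` fiber -> 0 < d ->
  exists v u : nat -> E,
    (forall k, [/\ subspace_set V (v k), `|v k| = 1, `|v k - u k| <= d,
                   fiber (u k) & `|u k| <= 1]) /\
    forall i k l, k != l ->
      slice_val Fiber (u k) i = 0 \/ slice_val Fiber (u l) i = 0.
Proof.
move=> VF d0.
have /choice[F FE] : forall N, exists p : E * E * nat,
    [/\ subspace_set V p.1.1, `|p.1.1| = 1, `|p.1.1 - p.1.2| <= d,
        fiber p.1.2 & `|p.1.2| <= 1] /\
    [/\ (N <= p.2)%N &
        forall i, ~~ (N <= i < p.2)%N -> slice_val Fiber p.1.2 i = 0].
  move=> N; have [v [u [N' h]]] := exists_block N VF d0.
  by exists (v, u, N').
pose N k := iter k (fun n => (F n).2) 0%N.
exists (fun k => (F (N k)).1.1), (fun k => (F (N k)).1.2).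
split=> [k|i k l]; first exact: (FE (N k)).1.
have Nmono k1 k2 : (k1 <= k2)%N -> (N k1 <= N k2)%N.
  move=> /subnK <-; elim: (k2 - k1)%N => // j IHj.
  by rewrite addSn; apply: leq_trans IHj _; have [_ []] := FE (N (j + k1)%N).
wlog kl : k l / (k < l)%N.
  by move=> h; rewrite neq_ltn => /orP[] kl; [|apply/or_comm]; apply: h => //;
    rewrite ltn_eqF.
move=> _; have [Ni|iN] := leqP (N l) i; [left|right].
  apply: (FE (N k)).2.2; rewrite negb_and -!ltnNge ltnS.
  by rewrite (leq_trans (Nmono k.+1 l kl) Ni) orbT.
by apply: (FE (N l)).2.2; rewrite negb_and -ltnNge iN.
Qed.

End NonSubprojectiveSlice.

(** * No subspace of the fiber is complemented when t > 0 *)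

Section NoComplement.
Context (R : realType) (t : R).
Hypothesis t0 : 0 < t.
Let E : completeNormedModType R := space_of (slice t).

(** Signs have entropy 0, so scaling by r s only adds a term linear in a. *)
Lemma entropy_scaled_sign (r s a : R) : 0 < r -> `|s| = 1 ->
  entropy (r * s * a) = r * s * (entropy a + ln r * a).
Proof.
move=> r0 s1; rewrite entropyM (entropyM r) (entropy_sign s1).
have -> : entropy r = r * ln r by rewrite /entropy gtr0_norm.
by ring.
Qed.

(** The sum is the lift of x, the combination of the u_k with coefficients
    r s_k, and x is in the unit ball of l2 because the u_k are disjointly
    supported and n r^2 <= 1.  The logarithmic term is the defect of linearity
    of the lift. *)
Lemma norm_combination_of_lifts_le
    (u z : nat -> E) (s : nat -> R) (r : R) (n : nat) :
  (forall k, fiber (u k)) -> (forall k, `|u k| <= 1) ->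
  (forall i k l, k != l ->
    slice_val Fiber (u k) i = 0 \/ slice_val Fiber (u l) i = 0) ->
  (forall k, slice_val Fiber (z k) =
     (fun i => t * entropy (slice_val Fiber (u k) i)) /\
     slice_val Base (z k) = slice_val Fiber (u k)) ->
  (forall k, `|s k| = 1) -> 0 < r -> n%:R * r ^+ 2 <= 1 ->
  `|\sum_(0 <= k < n) (r * s k) *: (z k + (t * ln r) *: u k)| <= 2 * t + 1.
Proof.
move=> Fu u1 udis zE s1 r0 nr.
pose a k i := slice_val Fiber (u k) i.
pose x i := \sum_(0 <= k < n) r * s k * a k i.
have xdis i k l : k != l -> r * s k * a k i = 0 \/ r * s l * a l i = 0.
  by move=> /(udis i)[]; rewrite /a => ->; rewrite mulr0; [left|right].
have x1 p : \sum_(0 <= i < p) x i ^+ 2 <= 1.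
  under eq_bigr => i _ do
    rewrite (disjoint_sum (f := fun b => b ^+ 2) _ (expr0n _ 2) (xdis i)).
  rewrite exchange_big /=; apply: le_trans nr.
  rewrite (_ : n%:R * r ^+ 2 = \sum_(0 <= k < n) r ^+ 2); last first.
    by rewrite sumr_const_nat subn0 mulr_natl.
  apply: ler_sum => k _; under eq_bigr do rewrite exprMn.
  rewrite -mulr_sumr exprMn -[s k ^+ 2]real_normK ?num_real// s1 expr1n mulr1.
  rewrite ler_piMr ?sqr_ge0//.
  apply: le_trans (slice_fiber_sqr_sum_le p (Fu k)) _.
  by rewrite exprn_ile1 ?u1.
have [w [wf wb wn]] := exists_lift (ltW t0) x1.
suff <- : w = \sum_(0 <= k < n) (r * s k) *: (z k + (t * ln r) *: u k) by [].
have sumE l i : slice_val l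
    (\sum_(0 <= k < n) (r * s k) *: (z k + (t * ln r) *: u k)) i =
    \sum_(0 <= k < n) r * s k *
      (slice_val l (z k) i + t * ln r * slice_val l (u k) i).
  etransitivity; first exact: scalar_sumZ (slice_val_scalar l i).
  by apply: eq_bigr => k _; rewrite slice_valD (slice_valZ l _ (u k)).
apply: slice_ext; apply/funext => i; rewrite sumE.
- rewrite wf /x (disjoint_sum _ (@entropy0 R) (xdis i)) mulr_sumr.
  apply: eq_bigr => k _; rewrite entropy_scaled_sign//.
  by rewrite (zE k).1 -/(a k i); ring.
- rewrite wb; apply: eq_bigr => k _.
  by rewrite (Fu k i) (zE k).2 mulr0 addr0.
Qed.

(** The norms of the w k below grow like ln m, whereas the bound on lifts, used
    with suitable signs, keeps their quadratic mean bounded. *)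
Lemma not_complemented_in_fiber (V : banach_subspace E) :
  subspace_set V `<=` fiber (t := t) -> ~ complemented (subspace_set V).
Proof.
move=> VF [P [Pc Pid PV]].
have VP w : subspace_set V (P w) by rewrite -PV; exists w.
have [C C0 PC] : exists2 C : R, 0 < C & forall w, `|P w| <= C * `|w|.
  have /linear_bounded_continuous/linear_boundedP/pinfty_ex_gt0[C C0 PC] := Pc.
  by exists C.
have Cn : C != 0 by rewrite gt_eqF.
(* With this distance to V, |P (v k) - P (u k)| is at most 1/2. *)
have d0 : 0 < (2 * C)^-1 by rewrite invr_gt0 mulr_gt0.
have [v [u [vuE udis]]] := exists_blocks VF d0.
have Fu k : fiber (u k) by have [] := vuE k.
have u1 k : `|u k| <= 1 by have [] := vuE k.
have Pu k : 2^-1 <= `|P (u k)|.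
  have [Vv v1 vu _ _] := vuE k.
  have Pv : P (v k) = v k.
    by have : range P (v k) by [rewrite PV]; move=> [w _ <-].
  have := ler_normD (P (u k)) (P (v k - u k)).
  rewrite -linearD addrC subrK Pv v1.
  have : C * `|v k - u k| <= 2^-1.
    rewrite (_ : 2^-1 = C * (2 * C)^-1); last by field.
    by rewrite ler_wpM2l// ltW.
  by have := PC (v k - u k); lra.
have /choice[z zE] : forall k, exists w : E,
    [/\ slice_val Fiber w = (fun i => t * entropy (slice_val Fiber (u k) i)),
        slice_val Base w = slice_val Fiber (u k) & `|w| <= 2 * t + 1].
  move=> k; apply: (exists_lift (ltW t0)) => n.
  apply: le_trans (slice_fiber_sqr_sum_le n (Fu k)) _.
  by rewrite exprn_ile1 ?u1.
pose K := C * (2 * t + 1).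
have Pz k : `|P (z k)| <= K.
  have [_ _ zn] := zE k; apply: le_trans (PC _) _.
  by rewrite ler_wpM2l// ltW.
have K0 : 0 <= K by rewrite mulr_ge0 ?(ltW C0)// addr_ge0 ?mulr_ge0 ?(ltW t0).
have log_le m : (0 < m)%N -> t * ln (m%:R : R) <= 4 * K.
  move=> m0; have mR : 0 < m%:R :> R by rewrite ltr0n.
  have lnV : ln (m%:R^-1 : R) = - ln (m%:R : R) by rewrite lnV ?posrE.
  pose w k := P (z k + (t * ln (m%:R^-1 : R)) *: u k).
  have Fw k : fiber (w k) by exact/VF/VP.
  have [s [s1 sw]] := exists_signs_norm_ge (@fiber_parallelogram R t)
    (@subspace_set0 _ _ (fiber_subspace t)) (@fiber_linear R t) Fw (m * m)%N.
  have wn k : t * ln (m%:R : R) / 2 - K <= `|w k|.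
    have -> : w k = P (z k) - (t * ln (m%:R : R)) *: P (u k).
      by rewrite /w lnV mulrN scaleNr linearB [P (_ *: _)]linearZ.
    have l0 : 0 <= t * ln (m%:R : R).
      by rewrite mulr_ge0 ?ln_ge0 ?ler1n// ltW.
    have := lerB_dist ((t * ln (m%:R : R)) *: P (u k)) (P (z k)).
    rewrite distrC normrZ (ger0_norm l0).
    by have := ler_wpM2l l0 (Pu k); have := Pz k; lra.
  have [|Kb] := leP (t * ln (m%:R : R) / 2 - K) 0; first by lra.
  have : `|\sum_(0 <= k < m * m) s k *: w k| <= m%:R * K.
    have := @norm_combination_of_lifts_le u z s m%:R^-1 (m * m) Fu u1 udis.
    rewrite invr_gt0 mR natrM exprVn -expr2 divff ?expf_neq0 ?gt_eqF//.
    move=> /(_ _ s1 isT (lexx _)) lift.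
    have {}lift := lift (fun k => ltac:(by have [] := zE k)).
    have : `|m%:R^-1 *: \sum_(0 <= k < m * m) s k *: w k| <= K.
      rewrite scaler_sumr.
      under eq_bigr => k _ do rewrite scalerA /w -linearZ.
      rewrite -linear_sum; apply: le_trans (PC _) _.
      by rewrite ler_wpM2l// ltW.
    by rewrite normrZ normfV normr_nat ler_pdivrMl.
  move=> sumK.
  have : (m%:R * (t * ln (m%:R : R) / 2 - K)) ^+ 2 <= (m%:R * K) ^+ 2.
    apply: (@le_trans _ _ (\sum_(0 <= k < m * m) `|w k| ^+ 2)).
      rewrite exprMn expr2 -natrM.
      rewrite (_ : _ * _ ^+ 2 =
          \sum_(0 <= k < m * m) (t * ln (m%:R : R) / 2 - K) ^+ 2).
        by apply: ler_sum => k _; rewrite lerXn2r ?nnegrE// ltW.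
      by rewrite sumr_const_nat subn0 mulr_natl.
    apply: le_trans sw _; rewrite lerXn2r ?nnegrE ?(mulr_ge0 (ltW mR) K0)//.
  rewrite ler_pXn2r ?nnegrE ?(mulr_ge0 (ltW mR))// ?(ltW Kb)//.
  by rewrite ler_pM2l//; lra.
have e0 := expR_gt0 (t^-1 * (4 * K)).
have mP := archi_boundP (ltW e0); set m := Num.bound _ in mP.
have mR : 0 < m%:R :> R by exact: lt_trans mP.
have := log_le m; rewrite -(ltr0n R) mR => /(_ isT); apply/negP; rewrite -ltNge.
by rewrite -ltr_pdivrMl// -ltr_expR lnK ?posrE.
Qed.

End NoComplement.

Lemma not_subprojective_slice (R : realType) (t : R) : 0 < t ->
  ~ subprojective (space_of (slice t)).
Proof.
move=> t0 /(_ (fiber_subspace t))[V [VF]].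
exact: not_complemented_in_fiber.
Qed.

Theorem proposition2p8 (R : realType) :
  exists (X : completeNormedModType R) (Y : banach_subspace X),
    subprojective (space_of Y) /\
    forall e : R, 0 < e ->
      exists Z : banach_subspace X,
        ~ subprojective (space_of Z) /\ gap Y Z <= e.
Proof.
exists (twisted_sum R), (slice 0); split; first exact: subprojective_slice0.
move=> e e0; have e2 : 0 < e / 2 by rewrite divr_gt0.
exists (slice (e / 2)); split; first exact: not_subprojective_slice.
by apply: le_trans (gap_slice_le (ltW e2)) _; rewrite mulrC divfK.
Qed.
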